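(* Let $A\subseteq\mathbb{N}$ and $k\in\mathbb{N}$. Then the following are equivalent: (1) There exist pairwise disjoint infinite sets $B_s\subseteq\mathbb{N}$ for $s=1,\ldots,k$ with $B_1\oplus\cdots\oplus B_k\subseteq A$. (2) There exist distinct non-principal ultrafilters $\mathcal{U}_1,\ldots,\mathcal{U}_k$ on $\mathbb{N}$ such that $A\in\mathcal{U}_1\oplus\cdots\oplus\mathcal{U}_k$.
   Context: $\mathbb{N}=\{1,2,3,\ldots\}$. For infinite sets $B_s=\{b_{s,1}<b_{s,2}<\cdots<b_{s,n}<\cdots\}\subseteq\mathbb{N}$, $s=1,\ldots,k$ (enumerated increasingly), $B_1\oplus\cdots\oplus B_k=\{b_{1,j_1}+\cdots+b_{k,j_k}\mid j_1<\cdots<j_k\}$. The pseudo-sum of ultrafilters $\mathcal{U},\mathcal{V}$ on $\mathbb{N}$ is the ultrafilter $\mathcal{U}\oplus\mathcal{V}$ on $\mathbb{N}$ defined by $A\in\mathcal{U}\oplus\mathcal{V}\iff\{n\in\mathbb{N}\mid A-n\in\mathcal{V}\}\in\mathcal{U}$, where $A-n=\{m\in\mathbb{N}\mid m+n\in A\}$. This operation is associative (but not commutative). *)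

(* Defs.v *)
From mathcomp Require Import all_boot all_classical.

Set Implicit Arguments.
Unset Strict Implicit.
Unset Printing Implicit Defensive.

Local Open Scope classical_set_scope.

Definition posnat : Type := {n : nat | 0 < n}.

Lemma posnat_add_gt0 (m n : posnat) : 0 < val m + val n.
Proof. by rewrite addn_gt0 (valP m). Qed.

Definition posnat_add (m n : posnat) : posnat :=
  exist (fun i => is_true (0 < i)) (val m + val n) (posnat_add_gt0 m n).

(* The index runs over 0, 1, 2, ... instead of 1, 2, 3, ...; only the order of
   the indices matters below. *)
Definition increasing_enum (B : set posnat) (b : nat -> posnat) : Prop :=
  {homo b : i j / i < j >-> val i < val j} /\ range b = B.

(* The set B_0 (+) ... (+) B_(k-1); each b s is the increasing enumeration of
   B s, which exists when B s is infinite (increasing_enum_exists) and is unique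
   (increasing_enum_unique). *)
Definition ordered_sumset (k : nat) (B : 'I_k -> set posnat) : set posnat :=
  [set x | exists (b : 'I_k -> nat -> posnat) (j : 'I_k -> nat),
     [/\ forall s, increasing_enum (B s) (b s),
         {homo j : s t / s < t} &
         val x = \sum_(s < k) val (b s (j s))]].

(* A - n *)
Definition set_shift (A : set posnat) (n : posnat) : set posnat :=
  [set m | A (posnat_add m n)].

Definition pseudo_sum (U V : set_system posnat) : set_system posnat :=
  [set A | U [set n | V (set_shift A n)]].

Fixpoint pseudo_sum_seq (s : seq (set_system posnat)) : set_system posnat :=
  match s with
  | [::] => set0 (* junk: the empty pseudo-sum is not defined *)
  | [:: U] => U
  | U :: s' => pseudo_sum U (pseudo_sum_seq s')
  end.

(* U_0 (+) ... (+) U_(k-1), bracketed to the right *)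
Definition iterated_pseudo_sum (k : nat) (U : 'I_k -> set_system posnat) :
  set_system posnat := pseudo_sum_seq [seq U s | s <- enum 'I_k].

Definition nonprincipal (U : set_system posnat) : Prop :=
  forall n : posnat, U <> principal_filter n.

Lemma posnat_addA : associative posnat_add.
Proof. by move=> m n p; apply: val_inj; rewrite /= addnA. Qed.

Lemma set_shift_shift (A : set posnat) (m n : posnat) :
  set_shift (set_shift A m) n = set_shift A (posnat_add n m).
Proof.
by apply/funext => p; rewrite /set_shift /= posnat_addA.
Qed.

Lemma pseudo_sumA : associative pseudo_sum.
Proof.
move=> U V W; apply/funext => A; rewrite /pseudo_sum /=.
congr U; apply/funext => m /=; congr V.
by apply/seteqP; split=> n /=; rewrite set_shift_shift.
Qed.

Lemma pseudo_sum_ultra (U V : set_system posnat) :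
  UltraFilter U -> UltraFilter V -> UltraFilter (pseudo_sum U V).
Proof.
move=> UU UV.
have PF : ProperFilter (pseudo_sum U V).
  apply: Build_ProperFilter_ex.
    move=> A UA; have [n /filter_ex[m Amn]] := @filter_ex _ U _ _ UA.
    by exists (posnat_add m n).
  split.
  - by apply: (@filterE _ U) => n; apply: (@filterE _ V).
  - move=> A C UA UC; apply: (@filterS2 _ U _ _ _ _ _ UA UC) => n.
    by apply: (@filterS2 _ V).
  - move=> A C AC; apply: (@filterS _ U) => n; apply: (@filterS _ V) => m.
    exact: AC.
split=> // G PG UG; apply/seteqP; split=> // A GA.
have [//|UnA] := in_ultra_setVsetC [set n | V (set_shift A n)] UU.
suff /UG GnA : pseudo_sum U V (~` A).
  by have [x []] := filter_ex (filterI GA GnA).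
apply: (@filterS _ U) UnA => n nVA.
by have [/nVA|] := in_ultra_setVsetC (set_shift A n) UV.
Qed.

Lemma increasing_enum_exists (B : set posnat) :
  infinite_set B -> exists b, increasing_enum B b.
Proof.
move=> Boo.
have next (n : nat) : exists x, [/\ B x, n <= val x &
    forall y, B y -> n <= val y -> val x <= val y].
  have [x0 [Bx0 nx0]] : exists x, B x /\ n <= val x.
    apply: contrapT => nB; apply: Boo.
    apply: (@sub_finite_set _ _ (val @^-1` `I_n)).
      by move=> x Bx /=; rewrite ltnNge; apply/negP => nx; apply: nB; exists x.
    apply: finite_preimage (finite_II n) => x y _ _; exact: val_inj.
  have exP : exists m, `[< exists x, [/\ B x, n <= val x & val x = m] >].
    by exists (val x0); apply/asboolP; exists x0.
  case: (ex_minnP exP) => m /asboolP[x [Bx nx <-]] mmin.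
  by exists x; split=> // y By ny; apply: mmin; apply/asboolP; exists y.
have [f fP] := choice next.
pose b := fix b i := if i is i'.+1 then f (val (b i')).+1 else f 0.
have bB i : B (b i).
  by case: i => [|i] /=; [case: (fP 0)|case: (fP (val (b i)).+1)].
have bS i : val (b i) < val (b i.+1) by case: (fP (val (b i)).+1).
have bmono : {homo b : i j / i < j >-> val i < val j}.
  move=> i j; elim: j => // j IH; rewrite ltnS leq_eqVlt => /predU1P[->//|ij].
  exact: ltn_trans (IH ij) (bS j).
exists b; split=> //; apply/seteqP; split=> [_ [i _ <-]//|x Bx].
apply: contrapT => nbx.
have nx i : b i <> x by move=> bix; apply: nbx; exists i.
have lex i : val (b i) < val x.
  elim: i => [|i IH]; rewrite ltn_neqAle; apply/andP; split.
  - by apply/eqP => /val_inj; apply: nx.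
  - by case: (fP 0) => _ _; apply.
  - by apply/eqP => /val_inj; apply: nx.
  - by case: (fP (val (b i)).+1) => _ _; apply.
have lei i : i <= val (b i).
  by elim: i => // i IH; exact: leq_ltn_trans IH (bS i).
by have := leq_ltn_trans (lei (val x)) (lex _); rewrite ltnn.
Qed.

Lemma increasing_enum_unique (B : set posnat) (b c : nat -> posnat) :
  increasing_enum B b -> increasing_enum B c -> b = c.
Proof.
suff le b' c' : increasing_enum B b' -> increasing_enum B c' ->
    forall i, val (b' i) <= val (c' i).
  move=> hb hc; apply/funext => i; apply/val_inj/eqP.
  by rewrite eqn_leq !le.
move=> [bm bB] [cm cB]; elim/ltn_ind => i IH.
have [m _ bmc] : range b' (c' i) by rewrite bB -cB; exists i.
rewrite -bmc; case: (ltngtP i m) => [/bm/ltnW//|mi|->//].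
by have := cm _ _ mi; rewrite -bmc ltnNge IH.
Qed.

(* Main.v *)
Require Import Defs.
From mathcomp Require Import all_boot all_classical.

(** Membership of [A] in a pseudo-sum [U_0 (+) ... (+) U_(k-1)] unfolds to the
nested quantifier: for [U_0]-many [n_0], for [U_1]-many [n_1], ..., for
[U_(k-1)]-many [n_(k-1)], the sum [n_0 + ... + n_(k-1)] lies in [A].
[iterated_mem] is this quantifier with the first [r] summands already chosen
and replaced by their sum [x]; a partial sum is called good when it holds.
Both implications compare it with the partial sums
[b_(0, j_0) + ... + b_(r-1, j_(r-1))], [j_0 < ... < j_(r-1) < n], of a table
[b]; these are finitely many, and [partial_sums] lists them.

From sets to ultrafilters, fix one ultrafilter [F] on the indices extending
the filter of cofinite sets, and let [U_s] be the image of [F] under the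
enumeration of [B_s]. The [U_s] are distinct because the [B_s] are disjoint.
Given a partial sum with all indices below [n], the next index may be anything
that is at least [n], and such indices are [F]-many; by descending induction on
the length every partial sum is good, the empty one included
([iterated_mem_image]).

From ultrafilters to sets, distinct ultrafilters contain pairwise disjoint sets
[C_s] ([ultra_separation]). The table is built column by column, keeping all
partial sums good. A new entry in row [s] has to lie in [C_s], to exceed the
earlier entries of its row, and to extend each of the finitely many partial
sums of length [s] to a good one: [U_s] contains the set of numbers meeting
these finitely many requirements, so one exists ([good_column_exists]). The
rows of the finished table are the [B_s], and a good sum of full length belongs
to [A]. *)

Set Implicit Arguments.
Unset Strict Implicit.
Unset Printing Implicit Defensive.

Local Open Scope classical_set_scope.

(** * Ultrafilters *)

Lemma filter_all_in (T : Type) (I : eqType) (F : set_system T) (s : seq I)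
    (P : I -> set T) :
  Filter F -> {in s, forall i, F (P i)} ->
  F [set x | {in s, forall i, P i x}].
Proof.
move=> FF; elim: s => [|i s IH] FP; first by apply: filterE => x i.
have Fs : F [set x | {in s, forall i, P i x}].
  by apply: IH => j sj; apply: FP; rewrite inE sj orbT.
apply: filterS2 (FP i (mem_head i s)) Fs => x Pix Psx j.
by rewrite inE => /predU1P[->|/Psx].
Qed.

Lemma ultraC (T : Type) (U : set_system T) (A : set T) :
  UltraFilter U -> ~ U A -> U (~` A).
Proof. by move=> UU; case: (in_ultra_setVsetC A UU). Qed.

Lemma ultra_sub_eq (T : Type) (U V : set_system T) :
  UltraFilter U -> UltraFilter V -> U `<=` V -> U = V.
Proof. by move=> UU UV UsubV; rewrite (@max_filter _ U UU V _ UsubV). Qed.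

Lemma fmap_ultra (S T : Type) (f : S -> T) (F : set_system S) :
  UltraFilter F -> UltraFilter (fmap f F).
Proof.
move=> UF; split=> [|G PG FG]; first exact: fmap_proper_filter.
apply/seteqP; split=> // A GA; apply: contrapT => /(ultraC UF) FnA.
by have [x []] := filter_ex (filterI GA (FG (~` A) FnA)).
Qed.

Lemma nonprincipal_neq (U : set_system posnat) (p : posnat) :
  UltraFilter U -> nonprincipal U -> U (~` [set p]).
Proof.
move=> UU Unp; apply: ultraC => Up; apply: (Unp p).
apply/esym/ultra_sub_eq => // [|A /principal_filterP Ap].
  exact: principal_filter_ultra.
by apply: filterS Up => _ ->.
Qed.

Lemma nonprincipal_gt (U : set_system posnat) (n : nat) :
  UltraFilter U -> nonprincipal U -> U [set m | n < val m].
Proof.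
move=> UU Unp.
have Uneq i : U [set m : posnat | val m != i].
  case: i => [|i]; first by apply: filterE => m /=; rewrite -lt0n (valP m).
  apply: filterS (nonprincipal_neq (exist _ i.+1 isT) UU Unp) => m /= mp.
  by apply/eqP => mi; apply: mp; apply: val_inj.
have Uall : {in iota 0 n.+1, forall i, U [set m : posnat | val m != i]}.
  by move=> i _; exact: Uneq.
apply: filterS (filter_all_in _ Uall) => m /= mn.
rewrite ltnNge; apply/negP => mlen.
have mi : val m \in iota 0 n.+1 by rewrite mem_iota ltnS.
by have := mn _ mi; rewrite eqxx.
Qed.

(** For each pair [s != t] some [D s t] belongs to [U s] and not to [U t]; the
set [C s] consists of the points that are in [D s t] and outside [D t s] for
every [t != s]. *)
Lemma ultra_separation (I : finType) (T : Type) (U : I -> set_system T) :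
  (forall s, UltraFilter (U s)) -> injective U ->
  exists C : I -> set T, trivIset setT C /\ forall s, U s (C s).
Proof.
move=> UU Uinj.
have sep (st : I * I) : exists D, st.1 != st.2 -> U st.1 D /\ ~ U st.2 D.
  case: st => s t /=; have [->|st] := eqVneq s t; first by exists setT.
  apply: contrapT => nD; case/eqP: st; apply/Uinj/ultra_sub_eq => // A UsA.
  by apply: contrapT => nUtA; apply: nD; exists A.
have [D DP] := choice sep.
exists (fun s => [set x | forall t, s != t -> D (s, t) x /\ ~ D (t, s) x]).
split.
  apply/trivIsetP => s t _ _ st; apply/seteqP; split=> // x [/= Cs Ct].
  by have [Dst _] := Cs t st; have [] := Ct s; rewrite 1?eq_sym.
move=> s; have: U s (\bigcap_t [set x | s != t -> D (s, t) x /\ ~ D (t, s) x]).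
  apply: filter_forall => t; have [<-|st] := eqVneq s t.
    by apply: filterE => x /=.
  have [Us _] := DP (s, t) st.
  have [_ nUs] : U t (D (t, s)) /\ ~ U s (D (t, s)).
    by apply: (DP (t, s)); rewrite eq_sym.
  by apply: filterS2 Us (ultraC (UU s) nUs) => x Dst Dts _; split.
by apply: filterS => x Cx t; exact: Cx.
Qed.

(** * Iterated pseudo-sums as nested quantifiers *)

(** [X] is a set of natural numbers, and not of positive ones, so that [x] can
be the empty sum. *)
Fixpoint iterated_mem (U : nat -> set_system posnat) (X : set nat)
    (r m x : nat) : Prop :=
  if m is m'.+1 then U r [set n | iterated_mem U X r.+1 m' (x + val n)]
  else X x.

Lemma pseudo_sum_seqE (U : nat -> set_system posnat) (X : set nat)
    (r m x : nat) :
  pseudo_sum_seq [seq U s | s <- iota r m.+1] [set n | X (x + val n)] =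
  iterated_mem U X r m.+1 x.
Proof.
elim: m r x => [//|m IH] r x.
have step n :
    pseudo_sum_seq [seq U s | s <- iota r.+1 m.+1]
      (set_shift [set p | X (x + val p)] n) =
    iterated_mem U X r.+1 m.+1 (x + val n).
  rewrite -IH; congr (pseudo_sum_seq _ _); apply/funext => p.
  by rewrite /set_shift /= [sval p + _]addnC addnA.
by rewrite [RHS]/= -(funext step).
Qed.

Lemma iterated_pseudo_sumE (k : nat) (U : 'I_k.+1 -> set_system posnat)
    (A : set posnat) :
  iterated_pseudo_sum U A =
  iterated_mem (fun s => U (inord s)) (val @` A) 0 k.+1 0.
Proof.
rewrite -pseudo_sum_seqE /iterated_pseudo_sum -val_enum_ord -map_comp.
congr (pseudo_sum_seq _ _).
  by apply: eq_map => s /=; rewrite inord_val.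
by apply/seteqP; split=> [n An|n [m Am /val_inj <-]] //=; exists n.
Qed.

(** * Partial sums of a table *)

(** The columns of the table, latest first. *)
Fixpoint history (T : Type) (b : nat -> T) (n : nat) : seq T :=
  if n is m.+1 then b m :: history b m else [::].

(** A sum of length [r.+1] that involves the latest column [c] takes its last
summand there, and its other summands from earlier columns. *)
Fixpoint partial_sums (h : seq (nat -> posnat)) (r : nat) : seq nat :=
  if h is c :: h' then
    partial_sums h' r ++
    (if r is r'.+1 then [seq x + val (c r') | x <- partial_sums h' r'] else [::])
  else nseq (r == 0) 0.

Lemma partial_sums_mono (b : nat -> nat -> posnat) (m n r : nat) :
  m <= n ->
  {subset partial_sums (history b m) r <= partial_sums (history b n) r}.
Proof.
elim: n => [|n IH]; first by rewrite leqn0 => /eqP->.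
rewrite leq_eqVlt => /predU1P[->//|mn] x /(IH mn) xn.
by rewrite /= mem_cat xn.
Qed.

Lemma partial_sums_extend (b : nat -> nat -> posnat) (i r x : nat) :
  x \in partial_sums (history b i) r ->
  x + val (b i r) \in partial_sums (history b i.+1) r.+1.
Proof. by move=> xi; rewrite /= mem_cat (map_f (fun y => _)) ?orbT. Qed.

Lemma partial_sumsP (b : nat -> nat -> posnat) (n r x : nat) :
  x \in partial_sums (history b n) r <->
  exists j : nat -> nat,
    [/\ {in gtn r &, {homo j : s t / s < t}}, forall s, s < r -> j s < n &
        x = \sum_(s < r) val (b (j s) s)].
Proof.
split.
  elim: n r x => [|n IH] [|r] x //=.
  - by rewrite inE => /eqP->; exists id; split=> //; rewrite big_ord0.
  - rewrite cats0 => /IH[j [jm jn ->]].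
    by exists j; split=> // s /jn/ltnW.
  - rewrite mem_cat => /orP[/IH[j [jm jn ->]]|/mapP[y /IH[j [jm jn ->]] ->]].
      by exists j; split=> // s /jn/ltnW.
    exists (fun s => if s < r then j s else n); split.
    + move=> s t; rewrite !inE !ltnS => sr tr st.
      have sr' : s < r by exact: leq_trans st tr.
      by rewrite sr'; case: ifP => [tr'|_]; [apply: jm; rewrite ?inE | exact: jn].
    + by move=> s _; case: ifP => [/jn/ltnW|_] //; rewrite ltnS.
    + rewrite big_ord_recr /= ltnn; congr (_ + _).
      by apply: eq_bigr => s _; rewrite ltn_ord.
case=> j [jm jn ->]; elim: r n jm jn => [|r IH] n jm jn.
  by rewrite big_ord0; apply: (partial_sums_mono (leq0n n)); rewrite inE.
rewrite big_ord_recr /=; apply: (@partial_sums_mono _ (j r).+1).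
  exact: jn.
apply: partial_sums_extend; apply: IH => [s t|s] sr.
  by move=> tr st; apply: jm => //; rewrite inE ltnS ltnW.
by apply: jm => //; rewrite inE ltnS // ltnW.
Qed.

(** * From sets to ultrafilters *)

Lemma iterated_mem_image (b : nat -> nat -> posnat) (F : set_system nat)
    (X : set nat) (k : nat) :
  Filter F -> \oo `<=` F ->
  (forall n x, x \in partial_sums (history b n) k -> X x) ->
  iterated_mem (fun s => fmap (fun n => b n s) F) X 0 k 0.
Proof.
move=> FF ooF bX; set U := fun s => _.
suff good m r : r + m = k -> forall n x,
    x \in partial_sums (history b n) r -> iterated_mem U X r m x.
  by apply: (good k 0 _ 0); rewrite // inE.
elim: m r => [|m IH] r; first by rewrite addn0 => -> n x; exact: bX.
rewrite addnS -addSn => /IH{}IH n x xn.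
have Fn : F [set i | n <= i] by apply: ooF; exists n.
rewrite -[iterated_mem _ _ _ _ _]/
  (F [set i | iterated_mem U X r.+1 m (x + val (b i r))]).
apply: filterS Fn => i ni; apply: (IH i.+1).
exact/partial_sums_extend/(partial_sums_mono ni).
Qed.

(** When [s != t], the preimages of [B s] under [b s] and [b t] are everything
and nothing, by disjointness. *)
Lemma image_ultra_inj (k : nat) (B : 'I_k -> set posnat)
    (b : 'I_k -> nat -> posnat) (F : set_system nat) :
  UltraFilter F -> trivIset setT B -> (forall s i, B s (b s i)) ->
  injective (fun s => fmap (b s) F).
Proof.
move=> UF Bdisj bB s t /= Fst.
have Fs : fmap (b s) F (B s) by apply: (@filterE _ F) => i; exact: bB.
rewrite Fst in Fs; have [i Bsi] := @filter_ex _ F _ _ Fs.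
by apply: Bdisj => //; exists (b t i).
Qed.

Lemma image_nonprincipal (b : nat -> posnat) (F : set_system nat) :
  UltraFilter F -> \oo `<=` F -> {homo b : i j / i < j >-> val i < val j} ->
  nonprincipal (fmap b F).
Proof.
move=> UF ooF bm p Fp.
have : fmap b F [set p] by rewrite Fp; apply/principal_filterP.
have Foo i : F [set i' | i < i'] by apply: ooF; exists i.+1.
move=> /= Fbp; have [i bi] := filter_ex Fbp.
have [i' [bi' /= /bm]] := filter_ex (filterI Fbp (Foo i)).
by rewrite bi bi' ltnn.
Qed.

Lemma ultrafilters_of_sets (A : set posnat) (k : nat)
    (B : 'I_k.+1 -> set posnat) :
  trivIset setT B -> (forall s, infinite_set (B s)) ->
  ordered_sumset B `<=` A ->
  exists U : 'I_k.+1 -> set_system posnat,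
     [/\ injective U,
         forall s, UltraFilter (U s),
         forall s, nonprincipal (U s) &
         iterated_pseudo_sum U A].
Proof.
move=> Bdisj Binf BA.
have [b bB] := choice (fun s => increasing_enum_exists (Binf s)).
have [F [UF ooF]] := ultraFilterLemma eventually_filter.
exists (fun s => fmap (b s) F); split.
- apply: (image_ultra_inj UF Bdisj) => s i.
  by have [_ <-] := bB s; exists i.
- by move=> s; exact: fmap_ultra.
- by move=> s; apply: image_nonprincipal => //; have [] := bB s.
rewrite iterated_pseudo_sumE.
apply: (@iterated_mem_image (fun n s => b (inord s) n)) => // n x.
move=> /partial_sumsP[j [jm jn ->]].
(* A sum of positive numbers is positive because it is not empty. *)
have x_gt0 : 0 < \sum_(s < k.+1) val (b (inord s) (j s)).
  by rewrite big_ord_recl addn_gt0 (valP (b _ _)).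
exists (exist (fun i => is_true (0 < i)) _ x_gt0) => //; apply: BA; exists b, (fun s => j (val s)).
split=> // [s t|/=]; first by apply: jm; rewrite inE.
by apply: eq_bigr => s _; rewrite inord_val.
Qed.

(** * From ultrafilters to sets *)

(** Columns are infinite, so a history also has partial sums of more than [k]
summands; these are left unconstrained. *)
Definition good_history (U : nat -> set_system posnat) (X : set nat) (k : nat)
    (h : seq (nat -> posnat)) : Prop :=
  forall r, r <= k ->
    {in partial_sums h r, forall x, iterated_mem U X r (k - r) x}.

Definition increasing_column (C : nat -> set posnat) (k : nat)
    (h : seq (nat -> posnat)) (c : nat -> posnat) : Prop :=
  forall s, s < k -> C s (c s) /\ forall d, d \in h -> val (d s) < val (c s).

Lemma good_column_exists (U : nat -> set_system posnat) (X : set nat)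
    (C : nat -> set posnat) (k : nat) (h : seq (nat -> posnat)) :
  (forall s, UltraFilter (U s)) -> (forall s, nonprincipal (U s)) ->
  (forall s, U s (C s)) -> good_history U X k h ->
  exists c, good_history U X k (c :: h) /\ increasing_column C k h c.
Proof.
move=> UU Unp UC hgood.
(* The entries in rows from [k] on are arbitrary. *)
have entry s : exists n, s < k ->
    [/\ C s n, forall d, d \in h -> val (d s) < val n &
        {in partial_sums h s,
          forall x, iterated_mem U X s.+1 (k - s.+1) (x + val n)}].
  case: (ltnP s k) => [sk|_]; last first.
    by have [n _] := filter_ex (UC s); exists n.
  have Ugt : {in h, forall d, U s [set n | val (d s) < val n]}.
    by move=> d _; exact: nonprincipal_gt.
  have Ugood : {in partial_sums h s, forall x,
      U s [set n | iterated_mem U X s.+1 (k - s.+1) (x + val n)]}.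
    by move=> x xs; have := hgood s (ltnW sk) x xs; rewrite -(subnSK sk).
  have [n [Cn [gtn goodn]]] := filter_ex (filterI (UC s)
    (filterI (filter_all_in _ Ugt) (filter_all_in _ Ugood))).
  by exists n.
have [c cP] := choice entry; exists c; split; last first.
  by move=> s /cP[Cs gts _].
move=> [|r] rk x /=; first by rewrite cats0; exact: hgood.
rewrite mem_cat => /orP[|/mapP[y yr ->]]; first exact: hgood.
by have [_ _] := cP r rk; apply.
Qed.

(** Dependent choice along the history. *)
Lemma history_choice (T : Type) (P : set (seq T)) (Q : seq T -> set T) :
  P [::] -> (forall h, P h -> exists c, P (c :: h) /\ Q h c) ->
  exists b : nat -> T, forall n, P (history b n) /\ Q (history b n) (b n).
Proof.
move=> P0 Pstep; have [t0 _] := Pstep _ P0.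
have next h : exists c, P h -> P (c :: h) /\ Q h c.
  by have [/Pstep[c]|nPh] := pselect (P h); [exists c | exists t0].
have [f fP] := choice next.
pose H := fix H n := if n is m.+1 then f (H m) :: H m else [::].
exists (fun n => f (H n)) => n.
have -> : history (fun n => f (H n)) n = H n by elim: n => //= n ->.
have PH : P (H n) by elim: n => //= n /fP[].
by split=> //; case: (fP _ PH).
Qed.

Lemma mem_history (T : eqType) (b : nat -> T) (m n : nat) :
  m < n -> b m \in history b n.
Proof.
elim: n => // n IH; rewrite ltnS leq_eqVlt inE => /predU1P[->|/IH->].
  by rewrite eqxx.
by rewrite orbT.
Qed.

Lemma increasing_infinite_range (b : nat -> posnat) :
  {homo b : i j / i < j >-> val i < val j} -> infinite_set (range b).
Proof.
move=> bm; have /eq_finite_set rangeE : (range b #= [set: nat])%card.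
  apply: inj_card_eq => i j _ _ bij.
  by case: (ltngtP i j) => // /bm; rewrite bij ltnn.
by rewrite rangeE; exact: infinite_nat.
Qed.

Lemma sets_of_ultrafilters (A : set posnat) (k : nat)
    (U : 'I_k.+1 -> set_system posnat) :
  injective U -> (forall s, UltraFilter (U s)) ->
  (forall s, nonprincipal (U s)) -> iterated_pseudo_sum U A ->
  exists B : 'I_k.+1 -> set posnat,
     [/\ trivIset setT B,
         forall s, infinite_set (B s) &
         ordered_sumset B `<=` A].
Proof.
move=> Uinj UU Unp; rewrite iterated_pseudo_sumE => UA.
have [C [Cdisj UC]] := ultra_separation UU Uinj.
pose V s := U (inord s).
have good0 : good_history V (val @` A) k.+1 [::].
  by move=> [|r] _ x //; rewrite inE => /eqP->.
have [b bP] := history_choice good0 (fun h => @good_column_exists V (val @` A)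
  (fun s => C (inord s)) k.+1 h (fun s => UU _) (fun s => Unp _) (fun s => UC _)).
have bC (s : 'I_k.+1) n : C s (b n s).
  by have [_ /(_ s (ltn_ord s))[]] := bP n; rewrite inord_val.
have bm (s : 'I_k.+1) : {homo b^~ s : m n / m < n >-> val m < val n}.
  move=> m n mn; have [_ /(_ s (ltn_ord s))[_]] := bP n.
  by apply; exact: mem_history.
exists (fun s => range (b^~ s)); split.
- move=> s t _ _ [_ [[m _ <-] [n _ bnm]]]; apply: Cdisj => //.
  by exists (b m s); split; [exact: bC | rewrite -bnm; exact: bC].
- by move=> s; exact: increasing_infinite_range.
move=> x [e [j [eB jm xE]]].
have eb s : e s = b^~ s by apply: increasing_enum_unique (eB s) _.
have : iterated_mem V (val @` A) k.+1 (k.+1 - k.+1) (val x).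
  (* [j] is increasing, so its last value bounds all column indices. *)
  have [good _] := bP (j ord_max).+1; apply: good => //.
  apply/partial_sumsP; exists (fun s => j (inord s)); split.
  - by move=> s t sk tk st; apply: jm; rewrite !inordK.
  - move=> s sk; rewrite ltnS; case: (ltngtP s k) => [s_k|ks|sk'].
    + by apply/ltnW/jm; rewrite inordK.
    + by have := leq_trans ks sk; rewrite ltnn.
    + by rewrite (_ : inord s = ord_max) //; apply: val_inj; rewrite /= inordK.
  - by rewrite xE; apply: eq_bigr => s _; rewrite eb inord_val.
by rewrite subnn => -[a Aa /val_inj <-].
Qed.

Theorem proposition6p9 (A : set posnat) (k : nat) (k_gt0 : (0 < k)%N) :
  (exists B : 'I_k -> set posnat,
     [/\ trivIset setT B,
         forall s, infinite_set (B s) &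
         ordered_sumset B `<=` A])
  <->
  (exists U : 'I_k -> set_system posnat,
     [/\ injective U,
         forall s, UltraFilter (U s),
         forall s, nonprincipal (U s) &
         iterated_pseudo_sum U A]).
Proof.
case: k k_gt0 => // k _; split.
  by case=> B []; exact: ultrafilters_of_sets.
by case=> U []; exact: sets_of_ultrafilters.
Qed.
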